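(* Let $X$ be a first countable, locally compact, paracompact, Hausdorff space and let $f:X\to X$ be a homeomorphism that is (topologically) expansive and has the (topological) shadowing property. Then the non-wandering set $\Omega(f)$ can be written as a union of pairwise disjoint closed invariant sets on each of which $f$ is topologically transitive. If $X$ is compact, then this decomposition is finite.
   Context: Write $\Delta_X=\{(x,x):x\in X\}\subset X\times X$ and $F=f\times f:X\times X\to X\times X$. A neighborhood of $\Delta_X$ is a subset of $X\times X$ containing an open set that contains $\Delta_X$. Expansive: $f$ is (topologically) expansive if there is a closed neighborhood $N$ of $\Delta_X$ such that for any distinct $x,y\in X$ there exists $n\in\mathbb Z$ with $F^n(x,y)\notin N$. Shadowing: for a neighborhood $D$ of $\Delta_X$, a $D$-pseudo-orbit is a bi-infinite sequence $\{x_i\}_{i\in\mathbb Z}$ in $X$ with $(f(x_{i-1}),x_i)\in D$ for all $i\in\mathbb Z$. For a neighborhood $E$ of $\Delta_X$, it is $E$-traced by $y\in X$ if $(f^i(y),x_i)\in E$ for all $i\in\mathbb Z$. $f$ has the (topological) shadowing property if for every neighborhood $E$ of $\Delta_X$ there is a neighborhood $D$ of $\Delta_X$ such that every $D$-pseudo-orbit is $E$-traced by some point $y\in X$. Non-wandering set: $\Omega(f)$ is the set of $x\in X$ such that for every open neighborhood $G$ of $x$ there is $n>0$ with $f^n(G)\cap G\neq\emptyset$. A set $R\subset X$ is invariant if $f(R)=R$. $f$ is topologically transitive on an invariant set $R$ if for any two non-empty relatively open subsets $G,H\subset R$ there exists $n\in\mathbb N=\{1,2,\dots\}$ with $f^n(G)\cap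 H\neq\emptyset$. *)

(* Defs.v *)
From HB Require Import structures.
From mathcomp Require Import all_boot all_order all_algebra.
From mathcomp Require Import all_classical topology.

Set Implicit Arguments.
Unset Strict Implicit.
Unset Printing Implicit Defensive.

Local Open Scope ring_scope.
Local Open Scope classical_set_scope.

Definition first_countable (X : topologicalType) : Prop :=
  forall x : X, exists2 B : set (set X), countable B &
    B `<=` nbhs x /\ (forall A, nbhs x A -> exists2 V, B V & V `<=` A).

Definition locally_finite (X : topologicalType) (V : set (set X)) : Prop :=
  forall x : X, exists2 W, nbhs x W &
    finite_set [set B | V B /\ B `&` W !=set0].

(* The Hausdorff property is not part of this definition. *)
Definition paracompact (X : topologicalType) : Prop :=
  forall U : set (set X), U `<=` open -> \bigcup_(A in U) A = [set: X] ->
  exists V : set (set X),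
    [/\ V `<=` open, \bigcup_(B in V) B = [set: X],
        (forall B, V B -> exists2 A, U A & B `<=` A) & locally_finite V].

Record homeomorphism (X : topologicalType) := Homeomorphism {
  homeo_fun :> X -> X;
  homeo_inv : X -> X;
  homeo_funK : cancel homeo_fun homeo_inv;
  homeo_invK : cancel homeo_inv homeo_fun;
  homeo_continuous : continuous homeo_fun;
  homeo_inv_continuous : continuous homeo_inv }.

(* Meant for mutually inverse h and k, in which case this is the integer power h^n. *)
Definition iterz (T : Type) (h k : T -> T) (n : int) : T -> T :=
  match n with
  | Posz m => iter m h
  | Negz m => iter m.+1 k
  end.

Definition square_map (T : Type) (h : T -> T) : T * T -> T * T :=
  fun p => (h p.1, h p.2).

Section dynamics.
Context {X : topologicalType}.
Implicit Types (f : homeomorphism X) (D E : set (X * X)) (x : int -> X).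
Implicit Types (R G : set X).

Definition diagonal_nbhs D : Prop :=
  exists U : set (X * X), [/\ open U, diagonal `<=` U & U `<=` D].

Definition expansive f : Prop :=
  exists N : set (X * X), [/\ closed N, diagonal_nbhs N &
    forall a b : X, a <> b -> exists n : int,
      ~ N (iterz (square_map f) (square_map (homeo_inv f)) n (a, b))].

Definition pseudo_orbit f D x : Prop := forall i : int, D (f (x (i - 1)), x i).

Definition traced f E x (y : X) : Prop :=
  forall i : int, E (iterz f (homeo_inv f) i y, x i).

Definition shadowing f : Prop :=
  forall E, diagonal_nbhs E -> exists2 D, diagonal_nbhs D &
    forall x, pseudo_orbit f D x -> exists y : X, traced f E x y.

Definition nonwandering f : set X :=
  [set a | forall G, open_nbhs a G ->
     exists2 n : nat, (0 < n)%N & (iter n f @` G) `&` G !=set0].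

Definition invariant_set f R : Prop := f @` R = R.

Definition relatively_open R G : Prop := exists2 U, open U & G = R `&` U.

Definition transitive_on f R : Prop :=
  forall G H : set X, relatively_open R G -> relatively_open R H ->
    G !=set0 -> H !=set0 ->
    exists2 n : nat, (0 < n)%N & (iter n f @` G) `&` H !=set0.

End dynamics.

(* Main.v *)
Require Import Defs.
From HB Require Import structures.
From mathcomp Require Import all_boot all_order all_algebra.
From mathcomp Require Import all_classical topology.
From mathcomp Require Import zify.

(* Write x ~> y if every neighbourhood of x has a positive iterate meeting any
   given neighbourhood of y. This relation is closed, x is non-wandering iff
   x ~> x, and shadowing makes it transitive, so mutual ~> is an equivalence
   relation on the non-wandering set with closed invariant classes. Tracing
   periodic pseudo-orbits, which by expansivity happens by periodic points,
   shows that periodic points are dense in the non-wandering set. Two periodic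
   points p, p' close to a common x satisfy p ~> p': the pseudo-orbit made of
   the past of p and the future of p' is traced by a point in the unstable set
   of p and the stable set of p'. Hence the classes are relatively open in the
   non-wandering set: a periodic point near a class lies in it, which gives
   transitivity, and compactness leaves only finitely many classes. *)

Import Order.TTheory GRing.Theory Num.Theory.

Local Open Scope ring_scope.
Local Open Scope classical_set_scope.

(** * Neighbourhoods of the diagonal *)

Lemma diagonal_nbhsP {X : topologicalType} (D : set (X * X)) :
  diagonal_nbhs D <-> forall x : X, nbhs (x, x) D.
Proof.
split=> [[U [oU dU UD]] x|nD].
  by apply: filterS UD _; apply: open_nbhs_nbhs; split=> //; exact: dU.
exists D°; split; [exact: open_interior| |exact: interior_subset].
by case=> x y; rewrite /diagonal /= => ->; exact: nD.
Qed.

Lemma diagonal_nbhsI {X : topologicalType} (D E : set (X * X)) :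
  diagonal_nbhs D -> diagonal_nbhs E -> diagonal_nbhs (D `&` E).
Proof.
by move=> /diagonal_nbhsP nD /diagonal_nbhsP nE; apply/diagonal_nbhsP => x;
  exact: filterI.
Qed.

Lemma diagonal_nbhs_refl {X : topologicalType} (D : set (X * X)) (x : X) :
  diagonal_nbhs D -> D (x, x).
Proof. by move=> /diagonal_nbhsP/(_ x)/nbhs_singleton. Qed.

Lemma diagonal_nbhs_square {X : topologicalType} (D : set (X * X)) (x : X) :
  diagonal_nbhs D -> exists2 U, nbhs x U & U `*` U `<=` D.
Proof.
move=> /diagonal_nbhsP/(_ x)[[P Q] /= [nP nQ] PQD].
exists (P `&` Q); first exact: filterI.
by move=> [a b] /= [[Pa _] [_ Qb]]; apply: PQD.
Qed.

Lemma locally_compact_nbhs {X : topologicalType} (x : X) :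
  locally_compact [set: X] -> exists2 K, nbhs x K & compact K.
Proof.
move=> /(_ x I) [K nK [cK _]]; exists K => //.
by move: nK; rewrite /within /=; apply: filterS => y; apply.
Qed.

Lemma locally_compact_regular {X : topologicalType} :
  locally_compact [set: X] -> hausdorff_space X ->
  forall (x : X) (U : set X), nbhs x U -> exists2 V, nbhs x V & closure V `<=` U.
Proof.
move=> lc hX x U nU; have [K nK cK] := locally_compact_nbhs x lc.
by have [V nV VU] := compact_regular hX cK nK nU; exists V.
Qed.

(** Turns tracing into localisation: a point that traces a point of [V] falls in [U]. Around [x] in
    [U] the conclusion holds; around any other [x] the premise fails, since the closure of [V] is
    avoided. *)
Lemma local_diagonal_nbhs {X : topologicalType} (U V : set X) :
  open U -> closure V `<=` U ->
  diagonal_nbhs [set p : X * X | V p.2 -> U p.1].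
Proof.
move=> oU VU; apply/diagonal_nbhsP => x.
have [Ux|nUx] := pselect (U x).
  exists (U, setT); last by case=> a b /= [].
  by split; [exact: open_nbhs_nbhs|exact: filterT].
exists (setT, ~` closure V); last first.
  by case=> a b /= [_ nVb] /subset_closure.
split; first exact: filterT.
apply: open_nbhs_nbhs; split; first exact/closed_openC/closed_closure.
by move/VU.
Qed.

(* [E] comes from a locally finite refinement of a cover by precompact sets [U]
   with [U `*` U `<=` N]. *)
Lemma compact_half_diagonal_nbhs {X : topologicalType} (N : set (X * X)) :
  locally_compact [set: X] -> paracompact X -> hausdorff_space X ->
  diagonal_nbhs N ->
  exists E : set (X * X), [/\ diagonal_nbhs E, E `<=` N,
    (forall a b x, E (a, x) -> E (b, x) -> N (a, b)) &
    (forall x, exists2 K, compact K & forall a, E (a, x) -> K a)].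
Proof.
move=> lc pX hX nN.
pose good U := [/\ open U, U `*` U `<=` N & exists2 K, compact K & U `<=` K].
pose cov := [set A : set X | open A /\ exists2 U, good U & closure A `<=` U].
have [| |V [oV Vcov Vref Vlf]] := pX cov.
- by move=> A [].
- rewrite -subTset => x _.
  have [K nK cK] := locally_compact_nbhs x lc.
  have [P nP PN] := diagonal_nbhs_square _ x nN.
  have nU : nbhs x (P `&` K)° by apply: nbhs_interior; exact: filterI.
  have [W nW WU] := locally_compact_regular lc hX _ _ nU.
  exists W°; last exact: nbhs_singleton (nbhs_interior nW).
  split; first exact: open_interior.
  exists (P `&` K)°.
    split; first exact: open_interior.
      move=> [a b] /= [/interior_subset[Pa _] /interior_subset[Pb _]].
      by apply: PN.
    by exists K => // a /interior_subset[].
  by apply: subset_trans WU; apply: closureS; exact: interior_subset.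
have /choice[u uP] : forall B : set X, exists U, V B ->
    good U /\ closure B `<=` U.
  move=> B; have [/Vref[A [_ [U gU AU]] BA]|nVB] := pselect (V B); last first.
    by exists set0.
  exists U => _; split=> //; apply: subset_trans AU; exact: closureS.
(* Constraining by every [B] whose closure contains the second coordinate avoids choosing one; local
   finiteness leaves finitely many constraints near each point. *)
pose E := [set p : X * X | forall B, V B -> closure B p.2 -> u B p.1].
have inV x : exists2 B, V B & closure B x.
  have : [set: X] x by [].
  by rewrite -Vcov => -[B VB Bx]; exists B => //; exact: subset_closure.
exists E; split.
- apply/diagonal_nbhsP => x.
  have [W nW finW] := Vlf x.
  (* The interior of [W] is open, so it meets [B] as soon as it meets the closure of [B]. *)
  pose S := [set B | V B /\ B `&` W° !=set0].
  have finS : finite_set S.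
    apply: sub_finite_set finW => B [VB [y [By /interior_subset Wy]]].
    by split=> //; exists y.
  pose g B := [set p : X * X | closure B p.2 -> u B p.1].
  have nG : nbhs (x, x) (\bigcap_(B in S) g B).
    have /finite_fsetP[F SF] := finS; rewrite SF.
    apply: filter_bigI => B BF; have [VB _] : S B by rewrite SF.
    have [[oU _ _] BU] := uP B VB.
    have := local_diagonal_nbhs _ (closure B) oU.
    rewrite -(closure_id (closure B)).1; last exact: closed_closure.
    by move=> /(_ BU)/diagonal_nbhsP.
  have nWx : nbhs (x, x) [set p : X * X | W° p.2].
    exists (setT, W°); last by case=> a b /= [].
    by split; [exact: filterT|exact: nbhs_interior].
  apply: filterS (filterI nG nWx) => -[a y] [/= Ga Wy] B VB cBy.
  apply: (Ga B) => //; split=> //; apply: cBy.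
  by apply: open_nbhs_nbhs; split=> //; exact: open_interior.
- case=> a x Eax; have [B VB cBx] := inV x.
  have [[_ UN _] BU] := uP B VB; apply: UN; split=> /=; last exact: BU.
  exact: Eax.
- move=> a b x Ea Eb; have [B VB cBx] := inV x.
  have [[_ UN _] BU] := uP B VB; apply: UN; split=> /=.
    exact: Ea.
  exact: Eb.
- move=> x; have [B VB cBx] := inV x.
  have [[_ _ [K cK UK]] _] := uP B VB; exists K => // a Ea.
  by apply: UK; exact: Ea.
Qed.

(** * Integer iterates of a homeomorphism *)

Section Iterates.
Context {X : topologicalType} (f : homeomorphism X).

Local Notation fz := (iterz f (homeo_inv f)).

Lemma iterzS (i : int) (x : X) : fz (i + 1) x = f (fz i x).
Proof.
case: i => [n|[|n]].
- by have -> : n%:Z + 1 = n.+1%:Z by lia.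
- by rewrite /= homeo_invK.
- have -> : Negz n.+1 + 1 = Negz n by lia.
  by rewrite /= homeo_invK.
Qed.

Lemma iterzD (i j : int) (x : X) : fz (i + j) x = fz i (fz j x).
Proof.
have fI := can_inj (homeo_funK f).
elim/int_ind: i => [|n IH|n IH]; first by rewrite add0r.
- have -> : n.+1%:Z + j = n%:Z + j + 1 by lia.
  have -> : n.+1%:Z = n%:Z + 1 by lia.
  by rewrite !iterzS IH.
(* Applying the injective [f] to both sides reduces the case of [- n.+1] to that of [- n]. *)
- apply: fI; rewrite -!iterzS.
  have -> : - n.+1%:Z + j + 1 = - n%:Z + j by lia.
  have -> : - n.+1%:Z + 1 = - n%:Z by lia.
  exact: IH.
Qed.

Lemma iterzK (i : int) (x : X) : fz i (fz (- i) x) = x.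
Proof. by rewrite -iterzD subrr. Qed.

Lemma iterz_square (i : int) (a b : X) :
  iterz (square_map f) (square_map (homeo_inv f)) i (a, b) = (fz i a, fz i b).
Proof.
have it h n : iter n (square_map h) (a, b) = (iter n h a, iter n h b).
  by elim: n => //= n ->.
by case: i => n; rewrite /iterz it.
Qed.

Lemma iterz_continuous (i : int) : continuous (fz i).
Proof.
have it (h : X -> X) n : continuous h -> continuous (iter n h).
  move=> hc; elim: n => [|n IH] x /=; first exact: cvg_id.
  exact: continuous_comp (IH x) (hc _).
case: i => n; apply: it; first exact: homeo_continuous.
exact: homeo_inv_continuous.
Qed.

Lemma iterz_periodic (q i : int) (p : X) : fz q p = p -> fz (i * q) p = p.
Proof.
move=> pq; elim/int_ind: i => [|n IH|n IH]; first by rewrite mul0r.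
- have -> : n.+1%:Z * q = q + n%:Z * q by lia.
  by rewrite iterzD IH.
- have -> : - n.+1%:Z * q = - q + - n%:Z * q by lia.
  by rewrite iterzD IH -{1}pq -iterzD addNr.
Qed.

End Iterates.

(** * The relation [leads] and its classes *)

Section Leads.
Context {X : topologicalType} (f : homeomorphism X).

Local Notation fz := (iterz f (homeo_inv f)).

(** Times lie in [int] so that they can be shifted against the indices of bi-infinite orbits. *)
Definition leads (x y : X) : Prop :=
  forall U V, nbhs x U -> nbhs y V ->
    exists2 n : int, 0 < n & exists2 a, U a & V (fz n a).

Lemma nonwandering_leads (x : X) : nonwandering f x <-> leads x x.
Proof.
split=> [nx U V nU nV|lx G [oG Gx]].
  have [|n n0 [_ [[a /interior_subset[Ua _] <-] /interior_subset[_ Va]]]] :=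
    nx (U `&` V)°.
    split; first exact: open_interior.
    by apply: nbhs_singleton; apply: nbhs_interior; exact: filterI.
  by exists n%:Z; [lia|exists a].
have nG : nbhs x G by exact: open_nbhs_nbhs.
have [[n|//] n0 [a Ga Ga']] := lx _ _ nG nG.
by exists n; [lia|exists (iter n f a); split=> //; exists a].
Qed.

(** This is closedness of the relation: the interior of a neighbourhood is a neighbourhood of each
    of its points. *)
Lemma leads_closure (x y : X) :
  (forall U V, nbhs x U -> nbhs y V ->
    exists x' y', [/\ U x', V y' & leads x' y']) -> leads x y.
Proof.
move=> H U V nU nV.
have [x' [y' [Ux' Vy']]] := H _ _ (nbhs_interior nU) (nbhs_interior nV).
exact.
Qed.

Definition leads_class (x : X) : set X := [set y | leads x y /\ leads y x].

Lemma leads_class_closed (x : X) : closed (leads_class x).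
Proof.
move=> y cly; split; apply: leads_closure => U V nU nV.
  have [z [[xz _] Vz]] := cly V nV; exists x, z; split=> //.
  exact: nbhs_singleton.
have [z [[_ zx] Uz]] := cly U nU; exists z, x; split=> //.
exact: nbhs_singleton.
Qed.

Lemma periodic_leads (q : int) (p : X) : 0 < q -> fz q p = p -> leads p p.
Proof.
move=> q0 pq U V nU nV; exists q => //.
by exists p; rewrite ?pq; exact: nbhs_singleton.
Qed.

Lemma leads_image_right (x y : X) : leads x y -> leads x (f y).
Proof.
move=> xy U V nU nV.
have [n n0 [a Ua Va]] := xy _ _ nU (@homeo_continuous _ f y _ nV).
by exists (n + 1); [lia|exists a => //; rewrite iterzS].
Qed.

Lemma leads_preimage_left (x y : X) : leads x y -> leads (homeo_inv f x) y.
Proof.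
move=> xy U V nU nV.
have [n n0 [a Ua Va]] := xy _ _ (@homeo_inv_continuous _ f x _ nU) nV.
exists (n + 1); first by lia.
exists (homeo_inv f a) => //.
by rewrite iterzD /= homeo_invK.
Qed.

(** * Consequences of shadowing: transitivity of the relation, invariance of the classes *)

Section Shadowing.
Context (f_shadowing : shadowing f).

(** The past of [a] followed by the future of [b] has a single jump, from [a] to [b] at index 0; all
    other pairs lie on the diagonal. *)
Lemma shadowing_splice (E : set (X * X)) : diagonal_nbhs E ->
  exists2 D, diagonal_nbhs D & forall a b, D (a, b) -> exists y,
    (forall i, i < 0 -> E (fz i y, fz i a)) /\
    (forall i, 0 <= i -> E (fz i y, fz i b)).
Proof.
move=> /f_shadowing[D nD DE]; exists D => // a b Dab.
have [|y ty] := DE (fun i => if i < 0 then fz i a else fz i b).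
  move=> i /=; case: ifPn => i1; case: ifPn => i0; try by lia.
  - by rewrite -iterzS subrK; exact: diagonal_nbhs_refl.
  - have -> : i = 0 by lia.
    by rewrite -iterzS subrK.
  - by rewrite -iterzS subrK; exact: diagonal_nbhs_refl.
exists y; split=> i i0; first by have := ty i; rewrite i0.
by have := ty i; rewrite ltNge i0.
Qed.

(** The orbit segment of length [n] from [z], repeated forever, jumps only at multiples of [n], from
    [fz n z] back to [z]. *)
Lemma shadowing_periodic (E : set (X * X)) : diagonal_nbhs E ->
  exists2 D, diagonal_nbhs D & forall z (n : int), 0 < n -> D (fz n z, z) ->
    exists p, forall i, E (fz i p, fz (i %% n)%Z z).
Proof.
move=> /f_shadowing[D nD DE]; exists D => // z n n0 Dz.
apply: DE => i /=; rewrite -iterzS.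
have ndiv := divz_eq i n; have := modz_ge0 i (lt0r_neq0 n0).
have := ltz_pmod i n0; set r := (i %% n)%Z in ndiv * => rn r0.
have [r1|r1] := eqVneq r 0.
- have -> : ((i - 1) %% n)%Z = n - 1.
    have -> : i - 1 = ((i %/ n)%Z - 1) * n + (n - 1) by lia.
    by rewrite modzMDl modz_small//; lia.
  by rewrite subrK r1.
- have -> : ((i - 1) %% n)%Z = r - 1.
    have -> : i - 1 = (i %/ n)%Z * n + (r - 1) by lia.
    by rewrite modzMDl modz_small//; lia.
  by rewrite subrK; exact: diagonal_nbhs_refl.
Qed.

Context (X_regular : forall (x : X) (U : set X), nbhs x U ->
  exists2 V, nbhs x V & closure V `<=` U).

Let localize (x : X) (U : set X) : nbhs x U ->
  exists V E, [/\ nbhs x V, diagonal_nbhs E &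
    forall a b, V b -> E (a, b) -> U a].
Proof.
move=> /nbhs_interior/X_regular[V nV VU].
exists V, [set p | V p.2 -> U° p.1]; split=> //.
  by apply: local_diagonal_nbhs => //; exact: open_interior.
by move=> a b Vb Ea; apply: interior_subset; exact: Ea.
Qed.

(** An orbit from near [x] to near [y] is spliced with one from near [y] to near [z]. Keeping both
    positive times shows that the total is at least 2. *)
Lemma leads_via (x y z : X) (U V W : set X) : leads x y -> leads y z ->
  nbhs x U -> nbhs y V -> nbhs z W ->
  exists a m n, [/\ 0 < m, 0 < n & [/\ U a, V (fz m a) & W (fz (m + n) a)]].
Proof.
move=> xy yz nU nV nW.
have [U' [E1 [nU' nE1 EU]]] := localize x U nU.
have [V' [E2 [nV' nE2 EV]]] := localize y V nV.
have [W' [E3 [nW' nE3 EW]]] := localize z W nW.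
have [D nD DE] := shadowing_splice _
  (diagonal_nbhsI _ _ nE1 (diagonal_nbhsI _ _ nE2 nE3)).
have [G nG GD] := diagonal_nbhs_square _ y nD.
have nVG : nbhs y (V' `&` G) by exact: filterI.
have [m m0 [a Ua [_ Ga]]] := xy _ _ nU' nVG.
have [n n0 [b [Vb Gb] Wb]] := yz _ _ nVG nW'.
have [|y' [Ey1 Ey2]] := DE (fz m a) b; first exact: GD.
(* The splice puts the passage near [y] at time 0, so the start lies [m] steps earlier. *)
exists (fz (- m) y'), m, n; split=> //; split.
- have [+ _] := Ey1 (- m) ltac:(lia).
  by rewrite -iterzD addNr; exact: EU.
- rewrite iterzK; have [_ [+ _]] := Ey2 0 (lexx _); exact: EV.
- rewrite addrC iterzD iterzK.
  by have [_ [_ +]] := Ey2 n (ltW n0); exact: EW.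
Qed.

Lemma leads_trans (x y z : X) : leads x y -> leads y z -> leads x z.
Proof.
move=> xy yz U W nU nW.
have [a [m [n [m0 n0 [Ua _ Wa]]]]] := leads_via _ _ _ U setT W xy yz nU filterT nW.
by exists (m + n); [lia|exists a].
Qed.

(** Returning near [x] first makes the travel time at least 2, so dropping one step leaves a
    positive time. *)
Lemma leads_image_left (x y : X) : leads x x -> leads x y -> leads (f x) y.
Proof.
move=> xx xy U V nU nV.
have [a [m [n [m0 n0 [Ua _ Va]]]]] :=
  leads_via _ _ _ _ _ _ xx xy (@homeo_continuous _ f x _ nU) filterT nV.
exists (m + n - 1); first by lia.
exists (f a) => //.
by rewrite -[f a]/(fz 1 a) -iterzD subrK.
Qed.

Lemma leads_preimage_right (x y : X) :
  leads x x -> leads x y -> leads x (homeo_inv f y).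
Proof.
move=> xx xy U V nU nV.
have [a [m [n [m0 n0 [Ua _ Va]]]]] :=
  leads_via _ _ _ _ _ _ xx xy nU filterT (@homeo_inv_continuous _ f y _ nV).
exists (m + n - 1); first by lia.
by exists a => //; rewrite addrC iterzD.
Qed.

Lemma leads_class_eq (x y : X) : leads_class x y -> leads_class x = leads_class y.
Proof.
move=> [xy yx]; apply/seteqP; split=> z [h1 h2]; split.
- exact: leads_trans yx h1.
- exact: leads_trans h2 xy.
- exact: leads_trans xy h1.
- exact: leads_trans h2 yx.
Qed.

Lemma leads_class_invariant (x : X) : invariant_set f (leads_class x).
Proof.
apply/seteqP; split=> [_ [y [xy yx] <-]|y [xy yx]].
  split; first exact: leads_image_right.
  by apply: leads_image_left => //; exact: leads_trans yx xy.
exists (homeo_inv f y); last exact: homeo_invK.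
split; last exact: leads_preimage_left.
by apply: leads_preimage_right => //; exact: leads_trans xy yx.
Qed.

Lemma leads_class_iterz (x y : X) (n : nat) :
  leads_class x y -> leads_class x (iter n f y).
Proof.
move=> xy; elim: n => //= n IH.
by rewrite -(leads_class_invariant x); exists (iter n f y).
Qed.

(** * Consequences of expansivity, with [E] a half of the separating neighbourhood [N] *)

Section Expansive.
Context (N E : set (X * X)) (N_closed : closed N)
  (N_separates : forall a b, (forall i, N (fz i a, fz i b)) -> a = b)
  (E_nbhs : diagonal_nbhs E) (E_sub : E `<=` N)
  (E_half : forall a b x, E (a, x) -> E (b, x) -> N (a, b))
  (E_compact : forall x, exists2 K, compact K & forall a, E (a, x) -> K a).

(** A loop from [x] through [y] back to [x] gives a periodic pseudo-orbit. Its tracing point and the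
    image of that point after one period trace the same sequence, so [N] never separates them and
    they agree. *)
Lemma leads_periodic (x y : X) (U V : set X) : leads x y -> leads y x ->
  nbhs x U -> nbhs y V ->
  exists p q m, [/\ 0 < q, fz q p = p & [/\ U p, 0 < m & V (fz m p)]].
Proof.
move=> xy yx nU nV.
have [U' [E1 [nU' nE1 EU]]] := localize x U nU.
have [V' [E2 [nV' nE2 EV]]] := localize y V nV.
have [D nD DE] := shadowing_periodic _
  (diagonal_nbhsI _ _ E_nbhs (diagonal_nbhsI _ _ nE1 nE2)).
have [G nG GD] := diagonal_nbhs_square _ x nD.
(* Both ends of the loop will lie in [G], so closing it up is a jump within [D]. *)
have nUG : nbhs x (U' `&` G) by exact: filterI.
have [z [m [n [m0 n0 [[Uz Gz] Vz [_ Gz']]]]]] :=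
  leads_via _ _ _ _ _ _ xy yx nUG nV' nUG.
have [||p Ep] := DE z (m + n); first by lia.
  by apply: GD.
exists p, (m + n), m; split; first by lia.
  apply: N_separates => i; apply: (E_half _ _ (fz (i %% (m + n))%Z z)).
    by rewrite -iterzD; have [+ _] := Ep (i + (m + n)); rewrite modzDr.
  by have [] := Ep i.
split=> //.
  by have [_ [+ _]] := Ep 0; rewrite mod0z; exact: EU.
have [_ [_ +]] := Ep m; rewrite modz_small; first exact: EV.
by lia.
Qed.

(* A cluster point of [fz (k * e) z] is never separated from [p], hence is
   [p]. *)
Lemma periodic_cluster (e : int) (p z : X) (K V : set X) (m : nat) :
  compact K -> fz e p = p ->
  (forall k : nat, (0 < k)%N -> K (fz (k%:Z * e) z)) ->
  (forall i, exists k0 : nat, forall k : nat, (k0 <= k)%N ->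
    N (fz (k%:Z * e + i) z, fz (k%:Z * e + i) p)) ->
  nbhs p V -> exists2 k : nat, (m <= k)%N & V (fz (k%:Z * e) z).
Proof.
move=> cK pe Kz Nz nV.
pose u (k : nat) := fz (k%:Z * e) z.
have uK : (u @ \oo) K by exists 1%N => // k /= k0; exact: Kz.
have [w [_ clw]] := cK (u @ \oo) _ uK.
suff wp : w = p.
  have [_ [[k /= mk <-] Vk]] : (u @` [set k | (m <= k)%N]) `&` V !=set0.
    apply: clw; last by rewrite wp.
    by exists m => // k /= mk; exists k.
  by exists k.
(* As [N] is closed, it is enough that each product neighbourhood of the pair of [i]-th iterates
   meets [N]. *)
apply: N_separates => i; apply: N_closed => B [[P Q] /= [nP nQ] PQB].
have [k0 Nk0] := Nz i.
have [_ [[k /= k0k <-] Pk]] :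
    (u @` [set k | (k0 <= k)%N]) `&` (fz i @^-1` P) !=set0.
  apply: clw; last exact: iterz_continuous.
  by exists k0 => // k /= mk; exists k.
exists (fz (k%:Z * e + i) z, fz (k%:Z * e + i) p); split; first exact: Nk0.
apply: PQB; split=> /=; first by rewrite addrC iterzD.
by rewrite addrC iterzD iterz_periodic//; exact: nbhs_singleton.
Qed.

(** The point tracing the spliced orbit accumulates at [p] along negative multiples of the common
    period [q * q'], and at [p'] along positive ones. *)
Lemma periodic_connect : exists2 D, diagonal_nbhs D &
  forall (p p' : X) (q q' : int), 0 < q -> fz q p = p ->
    0 < q' -> fz q' p' = p' -> D (p, p') -> leads p p'.
Proof.
have [D nD DE] := shadowing_splice _ E_nbhs.
exists D => // p p' q q' q0 pq q'0 pq' /DE[y [Ep Ep']] U V nU nV.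
have Q0 : 0 < q * q' by rewrite mulr_gt0.
have pQ : fz (- (q * q')) p = p by rewrite mulrC -mulNr iterz_periodic.
have p'Q : fz (q * q') p' = p' by rewrite iterz_periodic.
set Q := q * q' in Q0 pQ p'Q.
have [K cK EK] := E_compact p; have [K' cK' EK'] := E_compact p'.
have [k k1 Uk] : exists2 k : nat, (1 <= k)%N & U (fz (k%:Z * - Q) y).
  apply: (periodic_cluster _ p _ K) => // [j j0|i].
    have := Ep (j%:Z * - Q) ltac:(nia).
    by rewrite (iterz_periodic f _ j%:Z p)//; exact: EK.
  (* Since [Q] is at least 1, the index stays negative once [k] exceeds the absolute value of
     [i]. *)
  by exists (absz i).+1 => j ij; apply: E_sub; apply: Ep; nia.
have [k' k'1 Vk'] : exists2 k : nat, (1 <= k)%N & V (fz (k%:Z * Q) y).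
  apply: (periodic_cluster _ p' _ K') => // [j j0|i].
    have := Ep' (j%:Z * Q) ltac:(nia).
    by rewrite (iterz_periodic f _ j%:Z p')//; exact: EK'.
  by exists (absz i).+1 => j ij; apply: E_sub; apply: Ep'; nia.
exists ((k%:Z + k'%:Z) * Q); first by nia.
exists (fz (k%:Z * - Q) y) => //.
by rewrite -iterzD mulrN mulrDl [_ * Q + _]addrC addrK.
Qed.

(** Makes each class relatively open in the non-wandering set. Periodic points near [y] and [z] are
    still close to [x], hence related, and closedness passes to the limit. *)
Lemma leads_local (x : X) : exists2 U, nbhs x U &
  forall y z, U y -> U z -> leads y y -> leads z z -> leads y z.
Proof.
have [D nD Dp] := periodic_connect.
have [U nU UD] := diagonal_nbhs_square _ x nD.
exists U°; first exact: nbhs_interior.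
move=> y z Uy Uz yy zz; apply: leads_closure => P Q nP nQ.
have [p [q [_ [q0 pq [[Pp Up] _ _]]]]] :=
  leads_periodic _ _ _ _ yy yy (filterI nP Uy) filterT.
have [p' [q' [_ [q'0 pq' [[Qp' Up'] _ _]]]]] :=
  leads_periodic _ _ _ _ zz zz (filterI nQ Uz) filterT.
by exists p, p'; split=> //; apply: (Dp _ _ q q') => //; exact: UD.
Qed.

(** A periodic point near [y] whose orbit visits [V] is in the class by [leads_local]; by invariance
    the visit happens inside the class. *)
Lemma leads_class_transitive (x : X) : transitive_on f (leads_class x).
Proof.
move=> _ _ [U oU ->] [V oV ->] [y [Ry Uy]] [z [Rz Vz]].
have /leads_class_eq Exy := Ry.
rewrite Exy in Rz *; have [yz zy] := Rz.
have yy := leads_trans _ _ _ yz zy.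
have [W nW Wl] := leads_local y.
have nU : nbhs y U by exact: open_nbhs_nbhs.
have nV : nbhs z V by exact: open_nbhs_nbhs.
have [p [q [m [q0 pq [[Up Wp] m0 Vp]]]]] :=
  leads_periodic _ _ _ _ yz zy (filterI nU nW) nV.
have pp := periodic_leads _ _ q0 pq.
have Wy := nbhs_singleton nW.
have Rp : leads_class y p by split; exact: Wl.
case: m m0 Vp => // m m0 Vp; exists m; first by lia.
exists (iter m f p); split; first by exists p.
by split=> //; exact: leads_class_iterz.
Qed.

Lemma leads_class_finite : compact [set: X] ->
  finite_set [set R | exists2 x, leads x x & R = leads_class x].
Proof.
move=> /compact_near_coveringP cX.
(* Compactness is used in filter form, along families of classes that contain larger and larger
   finite families. *)
pose F : set_system (set (set X)) :=
  filter_from finite_set (fun A => [set S | A `<=` S]).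
have FF : Filter F.
  apply: filter_from_filter; first by exists set0; exact: finite_set0.
  move=> A B fA fB; exists (A `|` B); first by rewrite finite_setU.
  by move=> S /= ABS; split=> R ?; apply: ABS; [left|right].
have [|A fA AS] := cX _ F (fun S y => leads y y -> S (leads_class y)) FF.
  move=> x _.
  have [U nU Ul] := leads_local x.
  (* All points of [U] that lead to themselves share one class, so a single class serves the whole
     of [U]. *)
  have [[y [Uy yy]]|nU0] := pselect (exists y, U y /\ leads y y); last first.
    exists (U, setT); first by split; [|exact: filterT].
    by move=> [z S] /= [Uz _] zz; exfalso; apply: nU0; exists z.
  exists (U, [set S | [set leads_class y] `<=` S]).
    by split=> //=; exists [set leads_class y] => //; exact: finite_set1.
  move=> [z S] /= [Uz yS] zz; apply: yS => /=.
  by apply: leads_class_eq; split; exact: Ul.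
(* Taking [S] to be [A], the finite family itself contains every class. *)
apply: sub_finite_set fA => _ [x xx ->].
exact: (AS A).
Qed.

End Expansive.
End Shadowing.
End Leads.

(** * The decomposition of the non-wandering set *)

Theorem theorem3 (X : topologicalType) (f : homeomorphism X)
    (X_first_countable : first_countable X)
    (X_locally_compact : locally_compact [set: X])
    (X_paracompact : paracompact X)
    (X_hausdorff : hausdorff_space X)
    (f_expansive : expansive f)
    (f_shadowing : shadowing f) :
  exists C : set (set X),
    [/\ \bigcup_(R in C) R = nonwandering f,
        trivIset C id,
        (forall R, C R ->
           [/\ closed R, invariant_set f R & transitive_on f R])
      & (compact [set: X] -> finite_set C)].
Proof.
have [N [cN nN exN]] := f_expansive.
have sepN a b : (forall i,
    N (iterz f (homeo_inv f) i a, iterz f (homeo_inv f) i b)) -> a = b.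
  move=> Nab; apply: contrapT => /exN[i]; apply.
  by rewrite iterz_square.
have [E [nE EN Ehalf Ecpt]] := compact_half_diagonal_nbhs _
  X_locally_compact X_paracompact X_hausdorff nN.
have Xreg := @locally_compact_regular X X_locally_compact X_hausdorff.
exists [set R | exists2 x, leads f x x & R = leads_class f x]; split.
- apply/seteqP; split=> [y [_ [x xx ->]] [xy yx]|x /nonwandering_leads xx].
    by apply/nonwandering_leads; exact: leads_trans yx xy.
  by exists (leads_class f x) => //; exists x.
- move=> _ _ [x _ ->] [y _ ->] [z [xz yz]].
  have Ex := leads_class_eq f f_shadowing Xreg _ _ xz.
  by rewrite /= Ex -(leads_class_eq f f_shadowing Xreg _ _ yz).
- move=> _ [x xx ->]; split; first exact: leads_class_closed.
    exact: leads_class_invariant.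
  exact: leads_class_transitive cN sepN nE EN Ehalf Ecpt _.
- exact: leads_class_finite cN sepN nE EN Ehalf Ecpt.
Qed.
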